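(* There exists a non-sofic $\Pi^0_1$ $\mathbb{Z}^2$-subshift whose (horizontal) trace is $1$-sparse, i.e. in which every row of every configuration contains at most one nonzero symbol.
   Context: A $\mathbb{Z}^2$-subshift is a closed shift-invariant subset of $\Sigma^{\mathbb{Z}^2}$, $\Sigma \ni 0$ finite. It is a $\Pi^0_1$-subshift if it is defined by a recursively enumerable set of forbidden finite patterns. It is an SFT if it is defined by a finite set of forbidden finite patterns, and sofic if it is the image of an SFT under a shift-commuting continuous map. Rows are the one-dimensional configurations $j \mapsto x_{(j,i)}$, $i \in \mathbb{Z}$; the trace is the set of all rows of configurations of the subshift. *)

(* Defs.v *)
From HB Require Import structures.
From mathcomp Require Import all_boot all_order all_algebra.
From mathcomp Require Import all_classical all_reals all_analysis.

Set Implicit Arguments.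
Unset Strict Implicit.
Unset Printing Implicit Defensive.

Import GRing.Theory.
Local Open Scope classical_set_scope.
Local Open Scope ring_scope.

(* Partial recursive functions in Kleene's sense. A partial function          *)
(* N^k -> N is represented by its graph, [f v y] meaning f(v) = y.            *)

Definition graph (k : nat) := k.-tuple nat -> nat -> Prop.

(* (n, v) |-> h_n with h_0 = f(v) and h_(i+1) = g(i, h_i, v) *)
Definition primrec (k : nat) (f : graph k) (g : graph k.+2) : graph k.+1 :=
  fun v y => exists h : nat -> nat,
    [/\ f [tuple of behead v] (h 0%N),
        forall i, (i < thead v)%N ->
          g [tuple of i :: h i :: behead v] (h i.+1)
      & y = h (thead v)].

(* v |-> the y with f(y, v) = 0 such that f(z, v) is defined and nonzero for  *)
(* all z < y                                                                  *)
Definition minimize (k : nat) (f : graph k.+1) : graph k :=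
  fun v y => f [tuple of y :: v] 0%N /\
    forall z, (z < y)%N -> exists w, f [tuple of z :: v] w.+1.

Inductive partial_recursive : forall k : nat, graph k -> Prop :=
| PR_zero k : partial_recursive (fun (_ : k.-tuple nat) y => y = 0%N)
| PR_succ : partial_recursive (fun (v : 1.-tuple nat) y => y = (thead v).+1)
| PR_proj k (i : 'I_k) :
    partial_recursive (fun (v : k.-tuple nat) y => y = tnth v i)
| PR_comp k m (f : graph m) (g : 'I_m -> graph k) :
    partial_recursive f -> (forall i, partial_recursive (g i)) ->
    partial_recursive (fun v y =>
      exists2 w : m.-tuple nat, (forall i, g i v (tnth w i)) & f w y)
| PR_primrec k (f : graph k) (g : graph k.+2) :
    partial_recursive f -> partial_recursive g ->
    partial_recursive (primrec f g)
| PR_minimize k (f : graph k.+1) :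
    partial_recursive f -> partial_recursive (minimize f).

Definition recursively_enumerable (S : set nat) : Prop :=
  exists2 f : graph 1, partial_recursive f &
    forall n, S n <-> exists y, f [tuple n] y.

(* Cells of Z^2 are pairs (horizontal coordinate, vertical coordinate). *)
Definition cell : Type := (int * int)%type.

(* A^(Z^2) with the product of the discrete topologies *)
Definition config (A : finType) :=
  prod_topology (fun _ : cell => discrete_topology A).

Definition shift_config (A : finType) (v : cell) (x : config A) : config A :=
  fun u => x (u + v).

Definition subshift (A : finType) (X : set (config A)) : Prop :=
  closed X /\ forall v, shift_config v @` X = X.

(* A finite pattern, given by the list of its cells with their symbols. A     *)
(* list giving two symbols to one cell occurs nowhere, so forbidding it is    *)
(* harmless.                                                                  *)
Definition pattern (A : finType) : Type := seq (cell * A).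

Definition occurs (A : finType) (p : pattern A) (v : cell) (x : config A) :=
  forall c, c \in p -> x (v + c.1) = c.2.

Definition avoiding (A : finType) (P : set (pattern A)) : set (config A) :=
  [set x | forall p v, P p -> ~ occurs p v x].

(* Injective numberings of Z and of the patterns over A by natural numbers *)
Definition code_int (z : int) : nat :=
  match z with Posz n => n.*2 | Negz n => n.*2.+1 end.

Definition code_pattern (A : finType) (p : pattern A) : nat :=
  CodeSeq.code
    [seq CodeSeq.code [:: code_int c.1.1; code_int c.1.2;
                          nat_of_ord (enum_rank c.2)] | c <- p].

Definition Pi01 (A : finType) (X : set (config A)) : Prop :=
  exists2 P : set (pattern A),
    recursively_enumerable (@code_pattern A @` P) & X = avoiding P.

Definition SFT (A : finType) (X : set (config A)) : Prop :=
  exists P : seq (pattern A), X = avoiding [set` P].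

Definition sofic (A : finType) (X : set (config A)) : Prop :=
  exists (B : finType) (Y : set (config B)) (F : config B -> config A),
    [/\ SFT Y,
        {within Y, continuous F},
        forall v y, Y y -> F (shift_config v y) = shift_config v (F y)
      & X = F @` Y].

Definition config_row (A : finType) (x : config A) (i : int) : int -> A :=
  fun j => x (j, i).

Definition trace (A : finType) (X : set (config A)) : set (int -> A) :=
  [set r | exists x i, X x /\ r = config_row x i].

Definition sparse (A : finType) (zero : A) (k : nat) (T : set (int -> A)) :=
  forall r, T r -> ([set j | r j <> zero] #<= `I_k)%card.

(* Main.v *)
Require Import Defs.
From mathcomp Require Import all_boot all_order all_algebra.
From mathcomp Require Import all_classical all_reals all_analysis.
From mathcomp Require Import zify.

(** The subshift lives over the alphabet of booleans. Two families of finite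
    patterns are forbidden. The first, [row_pair], makes every row contain at
    most one true cell. The second, [skew_mirror], uses two vertically adjacent
    true cells as a marker of a horizontal mirror line: when a marker is
    present, the true cell in the row at height [d] above it may not lie in a
    column between that of the marker (included) and that of the true cell in
    the row at depth [d] below it (excluded). Both families are images of computable functions of
    natural parameters, so the subshift is effectively defined.

    It is not sofic because a square of side [m] carries about [m log m] bits
    of information that the outside must remember, whereas in a sofic shift
    only about [m] bits cross the boundary of a square. The configurations
    [mirror_config f] put a marker at the origin and record a function [f] from
    an [n]-element set to itself twice: above the marker, inside a square of
    side [2n], and symmetrically below it. There are [n ^ n] such functions. In
    a sofic shift with SFT cover over the alphabet [B], preimages of the
    configurations that agree on a thick frame around the square can exchange
    their contents inside the frame, and there are at most [#|B| ^ (c m)]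
    contents of the frame; this is [sofic_splice], which rests on the
    fact that a factor map reads a finite window ([sliding_block_window], a
    compactness argument). So for large [n] two different functions [f] and [g]
    can be exchanged inside the square, in both directions. Where [f] and [g]
    differ, one of the two exchanges has the upper true cell strictly to the
    left of the lower one, which is forbidden. Forbidding only one of the two
    strict inequalities thus suffices, and this keeps the set of forbidden
    patterns a union of two simply parametrised families. *)

Set Implicit Arguments.
Unset Strict Implicit.
Unset Printing Implicit Defensive.

Import Order.TTheory GRing.Theory.
Local Open Scope nat_scope.
Local Open Scope classical_set_scope.

(** * Computable functions *)

Definition computable (k : nat) (f : k.-tuple nat -> nat) : Prop :=
  partial_recursive (fun v y => y = f v).

Lemma partial_recursive_ext (k : nat) (f g : graph k) :
  (forall v y, f v y <-> g v y) -> partial_recursive f -> partial_recursive g.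
Proof.
move=> fg; suff -> : f = g by [].
by apply/funext => v; apply/funext => y; apply/propext.
Qed.

Lemma computable_ext (k : nat) (f g : k.-tuple nat -> nat) :
  f =1 g -> computable f -> computable g.
Proof. by move=> /funext ->. Qed.

Lemma computable_proj (k : nat) (i : 'I_k) : computable (fun v => tnth v i).
Proof. exact: PR_proj. Qed.

Lemma computable_comp (k m : nat) (f : m.-tuple nat -> nat)
    (g : 'I_m -> k.-tuple nat -> nat) :
  computable f -> (forall i, computable (g i)) ->
  computable (fun v => f [tuple g i v | i < m]).
Proof.
move=> cf cg; apply: partial_recursive_ext (PR_comp cf cg) => v y; split.
  move=> [w gw ->]; congr f; apply: eq_from_tnth => i.
  by rewrite gw tnth_mktuple.
by move=> ->; exists [tuple g i v | i < m] => // i; rewrite tnth_mktuple.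
Qed.

Lemma computable_comp1 (k : nat) (f : nat -> nat) (g : k.-tuple nat -> nat) :
  computable (fun v : 1.-tuple nat => f (thead v)) -> computable g ->
  computable (fun v => f (g v)).
Proof.
move=> cf cg; have := computable_comp cf (fun=> cg).
by apply: computable_ext => v; rewrite /thead tnth_mktuple.
Qed.

Lemma computable_comp2 (k : nat) (f : nat -> nat -> nat)
    (g h : k.-tuple nat -> nat) :
  computable (fun v : 2.-tuple nat => f (tnth v 0%R) (tnth v 1%R)) ->
  computable g -> computable h -> computable (fun v => f (g v) (h v)).
Proof.
move=> cf cg ch.
have cgh (i : 'I_2) : computable (if i == 0%R then g else h) by case: ifP.
have := computable_comp cf cgh.
by apply: computable_ext => v; rewrite !tnth_mktuple.
Qed.

Lemma computable_succ (k : nat) (f : k.-tuple nat -> nat) :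
  computable f -> computable (fun v => (f v).+1).
Proof. exact: computable_comp1 PR_succ. Qed.

Lemma computable_const (k c : nat) : computable (fun _ : k.-tuple nat => c).
Proof. by elim: c => [|c /computable_succ//]; exact: PR_zero. Qed.

Lemma computable_primrec (k : nat) (f : k.-tuple nat -> nat)
    (g : k.+2.-tuple nat -> nat) :
  computable f -> computable g ->
  computable (fun v : k.+1.-tuple nat =>
    nat_rect (fun=> nat) (f [tuple of behead v])
      (fun i h => g [tuple of i :: h :: behead v]) (thead v)).
Proof.
move=> cf cg; apply: partial_recursive_ext (PR_primrec cf cg) => v y.
set r := nat_rect _ _ _; split=> [[h [h0 hS ->]]|->].
  suff: forall i, i <= thead v -> h i = r i by apply.
  by elim=> [//|i IHi lt_iv]; rewrite /= hS // IHi // ltnW.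
by exists r.
Qed.

(** Unary recursion with one parameter, in the form in which addition,
    multiplication and subtraction are obtained. *)
Lemma computable_rec2 (f : nat -> nat) (g : nat -> nat -> nat -> nat) :
  computable (fun v : 1.-tuple nat => f (thead v)) ->
  computable (fun v : 3.-tuple nat => g (tnth v 0%R) (tnth v 1%R) (tnth v 2%R)) ->
  computable (fun v : 2.-tuple nat =>
    nat_rect (fun=> nat) (f (tnth v 1%R)) (fun i h => g i h (tnth v 1%R))
      (tnth v 0%R)).
Proof.
move=> cf cg; have := computable_primrec cf cg.
by apply: computable_ext => -[[|a [|b []]]].
Qed.

Lemma computable_add (k : nat) (f g : k.-tuple nat -> nat) :
  computable f -> computable g -> computable (fun v => f v + g v).
Proof.
apply: computable_comp2.
have := @computable_rec2 id (fun _ h _ => h.+1) (computable_proj _) _.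
move=> /(_ (computable_succ (computable_proj _))).
by apply: computable_ext => v /=; elim: (tnth v 0%R) => //= n ->.
Qed.

Lemma computable_mul (k : nat) (f g : k.-tuple nat -> nat) :
  computable f -> computable g -> computable (fun v => f v * g v).
Proof.
apply: computable_comp2.
have := @computable_rec2 (fun=> 0) (fun _ h b => b + h) (computable_const _ _) _.
move=> /(_ (computable_add (computable_proj _) (computable_proj _))).
by apply: computable_ext => v /=; elim: (tnth v 0%R) => //= n ->.
Qed.

Lemma computable_pow2 (k : nat) (f : k.-tuple nat -> nat) :
  computable f -> computable (fun v => 2 ^ f v).
Proof.
apply: computable_comp1.
have := @computable_primrec 0 (fun=> 1) (fun v => 2 * tnth v 1%R)
  (computable_const _ _) _.
move=> /(_ (computable_mul (computable_const _ _) (computable_proj _))).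
by apply: computable_ext => v; elim: (thead v) => //= n ->; rewrite expnS.
Qed.

Lemma computable_pred (k : nat) (f : k.-tuple nat -> nat) :
  computable f -> computable (fun v => (f v).-1).
Proof.
apply: computable_comp1.
have := @computable_primrec 0 (fun=> 0) (fun v => tnth v 0%R)
  (computable_const _ _) (computable_proj _).
by apply: computable_ext => v; case: (thead v).
Qed.

Lemma computable_sub (k : nat) (f g : k.-tuple nat -> nat) :
  computable f -> computable g -> computable (fun v => f v - g v).
Proof.
move=> cf cg; apply: (@computable_comp2 _ (fun a b => b - a)) => //.
have := @computable_rec2 id (fun _ h _ => h.-1) (computable_proj _) _.
move=> /(_ (computable_pred (computable_proj _))).
apply: computable_ext => v /=.
by elim: (tnth v 0%R) => [|n /= ->]; rewrite ?subn0 ?subnS.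
Qed.

Lemma computable_prod (k : nat) (b : k.-tuple nat -> nat)
    (f : k.+1.-tuple nat -> nat) :
  computable b -> computable f ->
  computable (fun v => \prod_(i < b v) f [tuple of val i :: v]).
Proof.
move=> cb cf.
have cP : computable (fun v : k.+1.-tuple nat =>
    \prod_(i < thead v) f [tuple of val i :: behead v]).
  have cfs : computable (fun w : k.+2.-tuple nat =>
      tnth w 1%R * f [tuple of thead w :: behead (behead w)]).
    apply: computable_mul; first exact: computable_proj.
    (* The projection list that drops the second entry, the accumulator. *)
    have cl (i : 'I_k.+1) : computable (fun w : k.+2.-tuple nat =>
        tnth w (if unlift ord0 i is Some j then lift ord0 (lift ord0 j) else ord0)).
      exact: computable_proj.
    apply: computable_ext (computable_comp cf cl) => w; congr f.
    apply: eq_from_tnth => i; rewrite tnth_mktuple.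
    case: unliftP => [j|] ->; last by rewrite tnth0.
    by rewrite !(tnth_nth 0) /= !nth_behead.
  have := computable_primrec (computable_const _ 1) cfs.
  apply: computable_ext => v; elim: (thead v) => [|n /= ->]; first by rewrite big_ord0.
  rewrite big_ord_recr /=; apply: congr2 => //; congr f; exact: val_inj.
have cb' (i : 'I_k.+1) : computable (fun v : k.-tuple nat =>
   if unlift ord0 i is Some j then tnth v j else b v).
  by case: unliftP => [j|] _ //; exact: computable_proj.
apply: computable_ext (computable_comp cP cb') => v.
set w := mktuple _; have -> : w = [tuple of b v :: v].
  apply: eq_from_tnth => i; rewrite tnth_mktuple.
  by case: unliftP => [j|] -> //; rewrite tnthS.
by apply: eq_bigr => i _; congr f; exact: val_inj.
Qed.

(** * Recursively enumerable sets *)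

(** The set is the domain of the unbounded search for [y]. *)
Lemma recursively_enumerable_exists (f : 2.-tuple nat -> nat) :
  computable f ->
  recursively_enumerable [set n | exists y, f [tuple y; n] = 0].
Proof.
move=> cf; exists (minimize (fun v y => y = f v)); first exact: PR_minimize.
have tE y n : f [tuple of y :: [tuple n]] = f [tuple y; n].
  by congr f; exact: val_inj.
move=> n; split=> [[y0 fy0]|[y [fy _]]]; last by exists y; rewrite -tE.
have ex : exists y, f [tuple y; n] == 0 by exists y0; apply/eqP.
case: (ex_minnP ex) => y /eqP fy y_min; exists y; split; rewrite ?tE // => z zy.
exists (f [tuple z; n]).-1; rewrite tE prednK // lt0n.
by apply: contraTneq zy => fz; rewrite -leqNgt y_min // fz.
Qed.

Lemma prod_ord_eq0 (n : nat) (F : 'I_n -> nat) :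
  (\prod_(i < n) F i == 0) = [exists i, F i == 0].
Proof.
by rewrite (big_morph (fun m => m == 0) muln_eq0 (erefl : (1 == 0) = false)) big_orE.
Qed.

(** Three existential quantifiers reduce to one: a triple of witnesses exists
    if and only if one exists below some common bound [y], and a search below
    [y] is a threefold product over the range [y]. The hypothesis states the
    computability of [d] by substitution, which spares the bookkeeping of
    tuples. *)
Lemma recursively_enumerable_exists3 (d : nat -> nat -> nat -> nat -> nat) :
  (forall k (a b c n : k.-tuple nat -> nat),
    computable a -> computable b -> computable c -> computable n ->
    computable (fun v => d (a v) (b v) (c v) (n v))) ->
  recursively_enumerable [set n | exists a b c, d a b c n = 0].
Proof.
move=> cd.
pose f (v : 2.-tuple nat) := let y := tnth v 0%R in
  \prod_(a < y) \prod_(b < y) \prod_(c < y) d a b c (tnth v 1%R).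
have cf : computable f.
  have cproj k i (lt_ik : i < k) : computable (fun v : k.-tuple nat => nth 0 v i).
    apply: computable_ext (computable_proj (Ordinal lt_ik)) => v.
    exact: tnth_nth.
  (* The entries of the tuple are, from the left: c, b, a, y, n. *)
  pose f3 (v : 5.-tuple nat) := d (nth 0 v 2) (nth 0 v 1) (nth 0 v 0) (nth 0 v 4).
  have cf3 : computable f3 by apply: cd; exact: cproj.
  have cf2 := computable_prod (cproj 4 2 isT) cf3.
  have cf1 := computable_prod (cproj 3 1 isT) cf2.
  apply: computable_ext (computable_prod (cproj 2 0 isT) cf1) => v.
  by rewrite /f !(tnth_nth 0).
have -> : [set n | exists a b c, d a b c n = 0] =
          [set n | exists y, f [tuple y; n] = 0].
  apply/seteqP; split=> n /=.
    move=> [a [b [c dn]]]; exists (a + b + c).+1; apply/eqP.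
    have lt_a : a < (a + b + c).+1 by lia.
    have lt_b : b < (a + b + c).+1 by lia.
    have lt_c : c < (a + b + c).+1 by lia.
    rewrite /f /= prod_ord_eq0; apply/existsP; exists (Ordinal lt_a).
    rewrite prod_ord_eq0; apply/existsP; exists (Ordinal lt_b).
    rewrite prod_ord_eq0; apply/existsP; exists (Ordinal lt_c).
    exact/eqP.
  move=> [y /eqP]; rewrite /f /= prod_ord_eq0 => /existsP[a].
  rewrite prod_ord_eq0 => /existsP[b].
  rewrite prod_ord_eq0 => /existsP[c /eqP dn].
  by exists a, b, c.
exact: recursively_enumerable_exists.
Qed.

(** * The forbidden patterns *)

Definition row_pair (k : nat) : pattern bool :=
  [:: ((Posz 0, Posz 0), true); ((Posz k.+1, Posz 0), true)].

(** Relative to the marker at heights 0 and 1, the row at height [t.+1] has its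
    true cell at [c] and the row at height [- t.+1] (that is, [Negz t]) has its
    true cell at [(c + s).+1], which is further right. All parameters range
    over the natural numbers without constraint, so that the pattern is a
    computable function of them without case distinctions. *)
Definition skew_mirror (c s t : nat) : pattern bool :=
  [:: ((Posz 0, Posz 0), true); ((Posz 0, Posz 1), true);
      ((Posz c, Posz t.+1), true); ((Posz (c + s).+1, Negz t), true)].

Definition forbidden : set (pattern bool) :=
  [set p | (exists k, p = row_pair k) \/ (exists c s t, p = skew_mirror c s t)].

Lemma computable_code (k : nat) (fs : seq (k.-tuple nat -> nat)) :
  List.Forall (@computable k) fs ->
  computable (fun v => CodeSeq.code [seq f v | f <- fs]).
Proof.
elim=> [|f {}fs cf _ IHfs]; first exact: computable_const.
apply: (computable_mul (computable_pow2 cf)).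
apply: computable_succ.
by apply: computable_ext (computable_add IHfs IHfs) => v; rewrite addnn.
Qed.

Lemma forbidden_re : recursively_enumerable (@code_pattern bool @` forbidden).
Proof.
(* A truncated-subtraction distance, zero exactly on equal arguments; the
   product [d] is then zero when [n] is the code of either pattern. *)
pose dist m n := (m - n) + (n - m).
have dist0 m n : (dist m n == 0) = (m == n) by rewrite /dist; lia.
pose d a b c n := dist (code_pattern (row_pair a)) n *
  dist (code_pattern (skew_mirror a b c)) n.
have -> : @code_pattern bool @` forbidden = [set n | exists a b c, d a b c n = 0].
  apply/seteqP; split=> n /=.
    move=> [p [[k ->]|[c [s [t ->]]]] <-].
      by exists k, 0, 0; apply/eqP; rewrite muln_eq0 !dist0 eqxx.
    by exists c, s, t; apply/eqP; rewrite muln_eq0 !dist0 eqxx orbT.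
  move=> [a [b [c /eqP]]]; rewrite muln_eq0 !dist0 => /orP[] /eqP <-.
    by exists (row_pair a) => //; left; exists a.
  by exists (skew_mirror a b c) => //; right; exists a, b, c.
apply: recursively_enumerable_exists3 => k a b c n ca cb cc cn.
have cdist f g : computable f -> computable g ->
    computable (fun v : k.-tuple nat => dist (f v) (g v)).
  by move=> cf cg; apply: computable_add; apply: computable_sub.
have cdouble f : computable f -> computable (fun v : k.-tuple nat => (f v).*2).
  by move=> cf; apply: computable_ext (computable_add cf cf) => v; rewrite addnn.
pose r : nat := enum_rank true.
pose K (j : nat) := fun _ : k.-tuple nat => j.
have cK j : computable (K j) by exact: computable_const.
pose code_fun fs := fun v : k.-tuple nat => CodeSeq.code [seq f v | f <- fs].
have ccode fs : List.Forall (@computable k) fs -> computable (code_fun fs).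
  exact: computable_code.
(* In both cases the list spells out the code of the pattern: a cell is the
   code of its two coordinates and of its symbol, and nonnegative and negative
   coordinates are numbered by the even and odd numbers respectively. *)
apply: computable_mul; apply: (cdist) => //.
  apply: (@ccode [:: code_fun [:: K 0; K 0; K r];
    code_fun [:: fun v => (a v).+1.*2; K 0; K r]]).
  do !(apply: List.Forall_cons || apply: List.Forall_nil || apply: ccode);
    by do ?[exact: cK|apply: cdouble|apply: computable_succ].
apply: (@ccode [:: code_fun [:: K 0; K 0; K r];
  code_fun [:: K 0; K 2; K r];
  code_fun [:: fun v => (a v).*2; fun v => (c v).+1.*2; K r];
  code_fun [:: fun v => (a v + b v).+1.*2; fun v => (c v).*2.+1; K r]]).
do !(apply: List.Forall_cons || apply: List.Forall_nil || apply: ccode);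
  by do ?[exact: cK|apply: cdouble|apply: computable_succ|apply: computable_add].
Qed.

(** * The topology of configurations *)

Definition box (r : nat) (c : cell) : bool := (`|c.1| <= r) && (`|c.2| <= r).

Lemma box_mono (r s : nat) (c : cell) : r <= s -> box r c -> box s c.
Proof. by rewrite /box; lia. Qed.

(** The cylinders around [x] form a filter that converges to [x] coordinate by
    coordinate, hence in the product topology; so it refines the
    neighbourhoods of [x]. *)
Lemma nbhs_config (A : finType) (x : config A) (N : set (config A)) :
  nbhs x N -> exists r, forall y, (forall c, box r c -> y c = x c) -> N y.
Proof.
pose cylinder r := [set y : config A | forall c, box r c -> y c = x c].
have cyl_filter : Filter (filter_from [set: nat] cylinder).
  apply: filter_fromT_filter; first by exists 0.
  move=> r s; exists (maxn r s) => y yx.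
  by split=> c cbox; apply: yx; apply: box_mono cbox; rewrite ?leq_maxl ?leq_maxr.
suff cyl_cvg : filter_from [set: nat] cylinder --> x.
  by move=> /cyl_cvg[r _ cyl_sub]; exists r => y /cyl_sub.
apply/cvg_sup => c U [_ [[W _ <-] Wxc WU]].
exists (maxn `|c.1| `|c.2|) => // y yx; apply: WU.
by rewrite /= yx // /box leq_maxl leq_maxr.
Qed.

Lemma nbhs_config_symbol (A : finType) (x : config A) (c : cell) :
  nbhs x [set y : config A | y c = x c].
Proof.
have xc := @discrete_set1 (discrete_topology A) (x c).
exact: (@proj_continuous _ (fun=> discrete_topology A) c x _ xc).
Qed.

Lemma config_compact (A : finType) : compact [set: config A].
Proof.
have Aco : compact [set: discrete_topology A].
  by apply: finite_compact; exact: (@finite_finset A).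
have := @tychonoff _ (fun _ : cell => discrete_topology A) _ (fun=> Aco).
by congr (compact _); rewrite eqEsubset.
Qed.

Lemma nbhs_occurs (A : finType) (p : pattern A) (v : cell) (x : config A) :
  occurs p v x -> nbhs x [set y : config A | occurs p v y].
Proof.
elim: p => [_|c p IHp xp].
  by apply: filterS filterT => y _ c; rewrite in_nil.
have xc : x (v + c.1)%R = c.2 by apply: xp; rewrite mem_head.
have {}IHp : nbhs x [set y : config A | occurs p v y].
  by apply: IHp => d pd; apply: xp; rewrite in_cons pd orbT.
near=> y => /= d; rewrite in_cons => /predU1P[->|].
  rewrite -xc; near: y; exact: nbhs_config_symbol.
by move: d; near: y.
Unshelve. all: by end_near. Qed.

Lemma nbhs_config_box (A : finType) (x : config A) (r : nat) :
  nbhs x [set y : config A | forall c, box r c -> y c = x c].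
Proof.
pose z (i : nat) : int := (Posz i - Posz r)%R.
pose p : pattern A :=
  [seq ((z i, z j), x (z i, z j)) | i <- iota 0 r.*2.+1, j <- iota 0 r.*2.+1].
have xp : occurs p 0%R x.
  by move=> _ /allpairsP[ij [_ _ ->]]; rewrite /= add0r.
apply: filterS (nbhs_occurs xp) => y yp [a b] /= box_ab.
have /yp : ((a, b), x (a, b)) \in p; last by rewrite add0r.
apply/allpairsP; exists (`|(a + Posz r)%R|%N, `|(b + Posz r)%R|%N) => /=.
have za : z `|(a + Posz r)%R|%N = a by rewrite /z; move: box_ab; rewrite /box /=; lia.
have zb : z `|(b + Posz r)%R|%N = b by rewrite /z; move: box_ab; rewrite /box /=; lia.
move: box_ab; rewrite /box /= => box_ab; split; last by rewrite za zb.
- by rewrite -[_ :: _]/(iota 0 r.*2.+1) mem_iota; lia.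
- by rewrite -[_ :: _]/(iota 0 r.*2.+1) mem_iota; lia.
Qed.

Lemma closed_avoiding (A : finType) (P : set (pattern A)) : closed (avoiding P).
Proof.
move=> x clx p v Pp /nbhs_occurs/clx[y [yP yp]]; exact: (yP p v).
Qed.

Lemma avoiding_shift (A : finType) (P : set (pattern A)) (v : cell) (x : config A) :
  avoiding P x -> avoiding P (shift_config v x).
Proof.
move=> xP p u Pp xp; apply: (xP p (u + v)%R Pp) => c pc.
by rewrite -(xp c pc) /shift_config addrAC.
Qed.

Lemma subshift_avoiding (A : finType) (P : set (pattern A)) : subshift (avoiding P).
Proof.
split=> [|v]; first exact: closed_avoiding.
apply/seteqP; split=> [_ [x xP <-]|x xP]; first exact: avoiding_shift.
exists (shift_config (- v)%R x); first exact: avoiding_shift.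
by apply/funext => u; rewrite /shift_config addrK.
Qed.

(** The Curtis-Hedlund-Lyndon theorem, at one cell. Continuity gives each
    configuration of [Y] a window that determines the symbol of its image at
    [c] on a neighbourhood; by compactness of [Y] finitely many of these
    neighbourhoods suffice, and hence one window. *)
Lemma sliding_block_window (A B : finType) (Y : set (config B))
    (F : config B -> config A) (c : cell) :
  closed Y -> {within Y, continuous F} ->
  exists r, forall y z, Y y -> Y z ->
    (forall d, box r d -> y d = z d) -> F y c = F z c.
Proof.
move=> Ycl /subspace_continuousP Fcont.
pose good r (y : config B) := Y y -> forall z, Y z ->
  (forall d, box r d -> y d = z d) -> F y c = F z c.
have Yco : compact Y.
  exact: subclosed_compact Ycl (@config_compact B) (@subsetT _ _).
have /compact_near_coveringP/(_ _ \oo good) := Yco.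
case=> [y Yy|r _ Yr]; last first.
  by exists r => y z Yy Yz; exact: (Yr r (leqnn r) y Yy Yy z Yz).
have /nbhs_config[r yr] : nbhs y [set z | Y z -> F z c = F y c].
  exact: (Fcont y Yy _ (@nbhs_config_symbol _ (F y) c)).
exists ([set z | forall d, box r d -> z d = y d], [set s | r <= s]).
  by split; [exact: nbhs_config_box|exists r].
move=> [z s] /= [zy rs] Yz w Yw zw; rewrite (yr z) ?(yr w) // => d rd.
by rewrite -zw ?zy // (box_mono rs).
Qed.

(** * Exchanging the contents of a square in a sofic shift *)

Definition splice (A : finType) (S : pred cell) (x y : config A) : config A :=
  fun c => if S c then x c else y c.

Definition square (o : cell) (m : nat) : pred cell := fun c =>
  ((o.1 <= c.1) && (c.1 < o.1 + Posz m) && (o.2 <= c.2) && (c.2 < o.2 + Posz m))%R.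

Lemma sft_radius (A : finType) (P : seq (pattern A)) :
  exists r, forall p c, p \in P -> c \in p -> box r c.1.
Proof.
exists (\max_(p <- P) \max_(c <- p) maxn `|c.1.1| `|c.1.2|) => p c Pp pc.
have le_p := @leq_bigmax_seq _ P xpredT
  (fun p => \max_(c <- p) maxn `|c.1.1| `|c.1.2|) p Pp isT.
have le_c := @leq_bigmax_seq _ p xpredT
  (fun c => maxn `|c.1.1| `|c.1.2|) c pc isT.
have := leq_trans le_c le_p.
by rewrite geq_max => /andP[c1 c2]; rewrite /box c1 c2.
Qed.

(** The frame around a square of side [m] is made of the cells at distance at
    most [2 * r] inside the boundary of the square enlarged by [r]. It is
    covered by four overlapping strips of thickness [2 * r] and length
    [m + 2 * r]; in the index, the first boolean tells whether the thickness is
    measured horizontally, the second one from which end. *)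
Definition band_index (r m : nat) : finType :=
  (bool * bool * 'I_(2 * r) * 'I_(m + 2 * r))%type.

Definition band (o : cell) (r m : nat) (t : band_index r m) : cell :=
  let: (horizontal, far, i, j) := t in
  let u := (if far then Posz (m + r) - Posz i.+1 else Posz i - Posz r)%R in
  let w := (Posz j - Posz r)%R in
  (o + if horizontal then (u, w) else (w, u))%R.

Lemma card_band_index (r m : nat) : #|band_index r m| = 8 * r * (m + 2 * r).
Proof. by rewrite !card_prod !card_bool !card_ord; lia. Qed.

(** A window of radius [r] whose centre lies outside the square meets the
    enlarged square only inside the frame. *)
Lemma band_cover (o v d : cell) (r m : nat) :
  ~~ square o m v -> box r d ->
  square (o - (Posz r, Posz r))%R (m + 2 * r) (v + d)%R ->
  exists t, @band o r m t = (v + d)%R.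
Proof.
case: o v d => [p1 p2] [v1 v2] [d1 d2]; rewrite /square /box /= => Sv rd Dvd.
(* Coordinates of the cell relative to the corner of the enlarged square. *)
pose a1 := (v1 + d1 - p1 + Posz r)%R; pose a2 := (v2 + d2 - p2 + Posz r)%R.
have bandP hor far (i j : nat) : i < 2 * r -> j < m + 2 * r ->
    (if far then Posz (m + 2 * r) - 1 - Posz i else Posz i)%R =
      (if hor then a1 else a2) ->
    Posz j = (if hor then a2 else a1) ->
    exists t, @band (p1, p2) r m t = ((v1, v2) + (d1, d2))%R.
  move=> lt_i lt_j ai aj; exists (hor, far, Ordinal lt_i, Ordinal lt_j).
  rewrite /band /=; move: ai aj; rewrite /a1 /a2.
  case: hor; case: far => ai aj; apply/pair_equal_spec; split=> /=; lia.
have [a1_near|a1_far] := boolP (a1 < Posz (2 * r))%R.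
  by apply: (bandP true false `|a1| `|a2|); rewrite /a1 /a2 in a1_near *; lia.
have [a1_far'|a1_far'] := boolP (Posz m <= a1)%R.
  apply: (bandP true true (absz (Posz (m + 2 * r) - 1 - a1)%R) `|a2|);
    rewrite /a1 /a2 in a1_far' *; lia.
have [a2_near|a2_far] := boolP (a2 < Posz (2 * r))%R.
  by apply: (bandP false false `|a2| `|a1|); rewrite /a1 /a2 in a1_far' a2_near *; lia.
apply: (bandP false true (absz (Posz (m + 2 * r) - 1 - a2)%R) `|a1|);
  rewrite /a1 /a2 in a1_far a1_far' a2_far *; lia.
Qed.

(** The pigeonhole principle for the frame. Take preimages in an SFT cover; let
    [r] bound both the forbidden patterns of the cover and the window of the
    factor map. If two preimages agree on the frame, splice them along the
    enlarged square. A window of radius [r] of the result is a window of the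
    inner preimage if its centre is in the square, and of the outer preimage
    otherwise. So the result belongs to the cover, and its image is the splice
    of the two images along the square itself. *)
Lemma sofic_splice (A : finType) (X : set (config A)) :
  sofic X -> exists K, forall m (o : cell) (I : finType) (x : I -> config A),
    0 < m -> (forall i, X (x i)) -> K ^ m < #|I| ->
    exists i j, [/\ i != j, X (splice (square o m) (x i) (x j))
                  & X (splice (square o m) (x j) (x i))].
Proof.
move=> [B [Y [F [[P YE] Fcont Fshift XE]]]].
have Yshift v y : Y y -> Y (shift_config v y) by rewrite YE; exact: avoiding_shift.
have Ycl : closed Y by rewrite YE; exact: closed_avoiding.
have [rP Prad] := sft_radius P.
have [rF Fwin] := sliding_block_window 0%R Ycl Fcont.
pose r := maxn rP rF.
pose agree (v : cell) (y z : config B) :=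
  forall d, box r d -> y (v + d)%R = z (v + d)%R.
have Y_local (z : config B) : (forall v, exists2 y, Y y & agree v z y) -> Y z.
  move=> zY; rewrite YE => p v Pp zp; have [y + zy] := zY v.
  rewrite YE => /(_ p v Pp); apply=> c pc; rewrite -(zp c pc) zy //.
  by apply: box_mono (Prad p c Pp pc); rewrite leq_maxl.
have F_local y z v : Y y -> Y z -> agree v y z -> F y v = F z v.
  move=> Yy Yz yz.
  have Fv w : Y w -> F w v = F (shift_config v w) 0%R.
    by move=> Yw; rewrite Fshift // /shift_config add0r.
  rewrite !Fv //; apply: Fwin => [||d dF]; try exact: Yshift.
  rewrite /shift_config ![(d + v)%R]addrC; apply: yz.
  by apply: box_mono dF; rewrite leq_maxr.
(* The frame has 8 r (m + 2 r) indices, at most 8 r (1 + 2 r) times m. *)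
exists (#|B| ^ (8 * r * (1 + 2 * r))) => m o I x m_gt0 Xx cardI.
have /choice[y yP] : forall i, exists y, Y y /\ F y = x i.
  by move=> i; move: (Xx i); rewrite XE => -[y Yy Fy]; exists y.
have spliceP i j :
    (forall t : band_index r m, y i (band o t) = y j (band o t)) ->
    X (splice (square o m) (x i) (x j)).
  move=> y_ij; have [[Yi Fi] [Yj Fj]] := (yP i, yP j).
  pose z := splice (square (o - (Posz r, Posz r))%R (m + 2 * r)) (y i) (y j).
  have z_in v : square o m v -> agree v z (y i).
    move=> Sv d rd; rewrite /z /splice ifT //.
    by move: Sv rd; rewrite /square /box /=; lia.
  have z_out v : ~~ square o m v -> agree v z (y j).
    move=> Sv d rd; rewrite /z /splice; case: ifP => // Dvd.
    by have [t <-] := band_cover Sv rd Dvd.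
  have Yz : Y z.
    apply: Y_local => v; have [Sv|Sv] := boolP (square o m v).
      by exists (y i) => //; exact: z_in.
    by exists (y j) => //; exact: z_out.
  rewrite XE; exists z => //; apply/funext => v; rewrite /splice -Fi -Fj.
  by case: ifPn => Sv; apply: F_local => //; [exact: z_in|exact: z_out].
pose sig i : {ffun band_index r m -> B} := [ffun t => y i (band o t) : B].
have /injectivePn[i [j ij /ffunP sig_ij]] : ~~ injectiveb sig.
  apply/injectiveP => /leq_card; rewrite card_ffun card_band_index leqNgt => /negP.
  apply; apply: leq_ltn_trans (cardI); rewrite -expnM.
  have /card_gt0P[i0 _] : 0 < #|I| by exact: leq_ltn_trans cardI.
  have B_gt0 : 0 < #|B| by apply/card_gt0P; exists (y i0 0%R).
  by apply: leq_pexp2l => //; nia.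
by exists i, j; split=> //; apply: spliceP => t; have := sig_ij t; rewrite !ffunE.
Qed.
(** * The subshift is 1-sparse and not sofic *)

Lemma occurs_cons (A : finType) (c : cell * A) (p : pattern A) (v : cell)
    (x : config A) :
  occurs (c :: p) v x <-> x (v + c.1)%R = c.2 /\ occurs p v x.
Proof.
split=> [xp|[xc xp] d]; last by rewrite in_cons => /predU1P[->|/xp].
by split=> [|d pd]; apply: xp; rewrite in_cons ?eqxx ?pd ?orbT.
Qed.

Lemma occurs_row_pair (x : config bool) (a b : int) (k : nat) :
  occurs (row_pair k) (a, b) x <-> x (a, b) /\ x (a + Posz k.+1, b)%R.
Proof.
have occurs0 : occurs [::] (a, b) x by [].
rewrite /row_pair !occurs_cons /=.
have -> : ((a, b) + (Posz 0, Posz 0) = (a, b))%R by exact: addr0.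
have -> : ((a, b) + (Posz k.+1, Posz 0) = (a + Posz k.+1, b))%R.
  by congr (_, _); exact: addr0.
by split=> [[xa [xb _]]|[xa xb]].
Qed.

Lemma occurs_skew_mirror (x : config bool) (a b : int) (c s t : nat) :
  occurs (skew_mirror c s t) (a, b) x <->
  [/\ x (a, b), x (a, b + 1)%R, x (a + Posz c, b + Posz t.+1)%R
    & x (a + Posz (c + s).+1, b - Posz t.+1)%R].
Proof.
have occurs0 : occurs [::] (a, b) x by [].
rewrite /skew_mirror !occurs_cons /=.
have -> : ((a, b) + (Posz 0, Posz 0) = (a, b))%R by exact: addr0.
have -> : ((a, b) + (Posz 0, Posz 1) = (a, b + 1))%R.
  by congr (_, _); exact: addr0.
by split=> [[x0 [x1 [x2 [x3 _]]]]|[x0 x1 x2 x3]].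
Qed.

(** The row at height [k.*2 + 4] and its mirror image have their true cell in
    column [f k]. Using only even heights from 4 on leaves a gap next to every
    true cell except for the two of the marker, so that there is no other
    marker. *)
Definition mirror_config (n : nat) (f : 'I_n -> 'I_n) : config bool := fun c =>
  [&& c.1 == 0%R & (c.2 == 0%R) || (c.2 == 1%R)] ||
  [exists k : 'I_n, (c.1 == Posz (f k)) && (`|c.2| == k.*2 + 4)].

Lemma mirror_config_allowed (n : nat) (f : 'I_n -> 'I_n) :
  avoiding forbidden (mirror_config f).
Proof.
have xP c : mirror_config f c -> (c.1 = 0%R /\ (c.2 = 0%R \/ c.2 = 1%R)) \/
    exists2 k : 'I_n, c.1 = Posz (f k) & `|c.2| = k.*2 + 4.
  case/orP=> [/andP[/eqP-> /orP[]/eqP->]|/existsP[k /andP[/eqP c1 /eqP c2]]].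
  - by left; split=> //; left.
  - by left; split=> //; right.
  - by right; exists k.
move=> p [a b] [[k ->]|[c [s [t ->]]]].
  rewrite occurs_row_pair => -[/xP x0 /xP xk] /=.
  case: x0 xk => [[/= -> b01]|[i /= -> bi]] [[/= a0 b01']|[j /= aj bj]].
  - by [].
  - by lia.
  - by lia.
  - have ij : i = j by apply: val_inj => /=; lia.
    by rewrite ij in aj; lia.
rewrite occurs_skew_mirror => -[/xP x0 /xP x1 /xP xc /xP xs].
(* The only marker is the intended one, at the origin. *)
have [a0 b0] : a = 0%R /\ b = 0%R.
  by case: x0 x1 => [[/= -> b01]|[i /= -> bi]] [[/= a0 b01']|[j /= aj bj]]; lia.
subst a b => {x0 x1}; rewrite /= in xc xs.
case: xc xs => [[/= c0 t0]|[i /= ci ti]] [[/= cs0 ts0]|[j /= sj tj]]; try lia.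
have ij : i = j by apply: val_inj => /=; lia.
by rewrite ij in ci; lia.
Qed.

Lemma not_sofic_forbidden : ~ sofic (avoiding forbidden).
Proof.
case/sofic_splice => K Ksplice.
(* The side of the square is 2 n, and K ^ (2 n) < n ^ n for this n. *)
pose n := (K ^ 2).+1; pose o : cell := (Posz 0, Posz 4).
have splice_mirror (f g : 'I_n -> 'I_n) (k : 'I_n) : f k < g k ->
    ~ avoiding forbidden
        (splice (square o n.*2) (mirror_config f) (mirror_config g)).
  move=> fg /(_ (skew_mirror (f k) (g k - (f k).+1) (k.*2 + 3)) (Posz 0, Posz 0)).
  apply; first by right; exists (f k), (g k - (f k).+1), (k.*2 + 3).
  have rowE : (k.*2 + 3).+1 = k.*2 + 4 by lia.
  have colE : (f k + (g k - (f k).+1)).+1 = g k by lia.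
  apply/occurs_skew_mirror; rewrite !add0r rowE colE.
  have [lt_k lt_f] := (ltn_ord k, ltn_ord (f k)).
  have onE (h : 'I_n -> 'I_n) (b : int) :
      `|b| = k.*2 + 4 -> mirror_config h (Posz (h k), b).
    by move=> bE; apply/orP; right; apply/existsP; exists k; rewrite /= bE !eqxx.
  rewrite /splice; split.
  - by [].
  - by [].
  - by rewrite ifT; [exact: onE|rewrite /square /=; lia].
  - by rewrite ifF; [apply: onE; lia|rewrite /square /=; lia].
have [||f [g [fg Xfg Xgf]]] :=
  Ksplice n.*2 o {ffun 'I_n -> 'I_n} (fun f => mirror_config f) isT.
- by move=> f; exact: mirror_config_allowed.
- by rewrite card_ffun card_ord -mul2n expnM ltn_exp2r.
have [k fgk] : exists k, f k != g k.
  apply/existsP; apply: contraNT fg => /existsPn fg; apply/eqP/ffunP => k.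
  by apply/eqP; move/negPn: (fg k).
have [|lt_gf|eq_fg] := ltngtP (f k) (g k).
- by move/splice_mirror.
- exact: (splice_mirror _ _ _ lt_gf Xgf).
- by case/negP: fgk; apply/eqP/val_inj.
Qed.

Lemma sparse_forbidden : sparse false 1 (trace (avoiding forbidden)).
Proof.
move=> _ [x [i [xP ->]]].
have row_le1 j k : x (j, i) -> x (k, i) -> (k <= j)%R.
  move=> xj xk; rewrite leNgt; apply/negP => lt_jk.
  apply: (xP (row_pair `|(k - j - 1)%R|) (j, i)).
    by left; exists `|(k - j - 1)%R|.
  apply/occurs_row_pair; split=> //=.
  by have -> : (j + Posz `|(k - j - 1)%R|.+1 = k)%R by lia.
have row1 j k : x (j, i) -> x (k, i) -> j = k.
  by move=> xj xk; apply: le_anti; rewrite !row_le1.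
have [j0 row_sub] : exists j0, [set j | config_row x i j <> false] `<=` [set j0].
  have [[j0 xj0]|row0] := pselect (exists j, x (j, i)).
    by exists j0 => j /=; case xj: (config_row x i j) => // _; exact: row1.
  exists 0%R => j /=; case xj: (config_row x i j) => // _.
  by case: row0; exists j.
rewrite -(card_le_eqr (@card_set1 _ j0)); exact: subset_card_le.
Qed.

Theorem proposition7p8 :
  exists (A : finType) (zero : A) (X : set (config A)),
    [/\ subshift X, Pi01 X, ~ sofic X & sparse zero 1 (trace X)].
Proof.
exists bool, false, (avoiding forbidden); split.
- exact: subshift_avoiding.
- by exists forbidden => //; exact: forbidden_re.
- exact: not_sofic_forbidden.
- exact: sparse_forbidden.
Qed.
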